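(* Let $p$ be an odd prime, $r=(p-1)/2$, $\zeta_p=e^{2\pi i/p}$, $\varepsilon=(-1)^{(p-1)/2}$, and let $\sqrt{\varepsilon p}=\sum_{x\in\mathbb{Z}/p\mathbb{Z}}\zeta_p^{x^2}$. Let $Q$ be either $Q_1(x)=x^2/p$ or $Q_2(x)=cx^2/p$ with $c$ a fixed quadratic non-residue mod $p$, and $B(x,y)=Q(x+y)-Q(x)-Q(y)$. Let $S$ be the $(r+1)\times(r+1)$ matrix indexed by $0\le j,k\le r$ with $S_{j0}=1/\sqrt{\varepsilon p}$ for all $j$, $S_{0k}=2/\sqrt{\varepsilon p}$ for $1\le k\le r$, and $S_{jk}=\frac{1}{\sqrt{\varepsilon p}}\left(e^{-2\pi iB(j,k)}+e^{2\pi iB(j,k)}\right)$ for $1\le j,k\le r$. Let $\theta_j=e^{2\pi iQ(j)}$ ($0\le j\le r$) and let $V_Q$ be the Vandermonde matrix with $(j,k)$ entry $\theta_j^{\,k}$ ($0\le j,k\le r$). Then every entry of $S'=V_Q^{-1}SV_Q$ lies in $\mathbb{Z}\left[\frac{1}{2}(1+\sqrt{\varepsilon p})\right]$, the ring of integers of $\mathbb{Q}(\sqrt{\varepsilon p})$.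
   Context: $\sqrt{\varepsilon p}$ equals $\sqrt p$ if $p\equiv1\pmod 4$ and $i\sqrt p$ if $p\equiv 3\pmod 4$. The $\theta_j$ are pairwise distinct, so $V_Q$ is invertible. $S$ is (up to sign) the matrix of $\mathfrak{s}=\begin{pmatrix}0&-1\\1&0\end{pmatrix}$ in the Weil representation of $\mathrm{SL}_2(\mathbb{F}_p)$ attached to $Q$, restricted to even functions on $\mathbb{Z}/p\mathbb{Z}$ in the basis $\delta_0,\delta_1+\delta_{p-1},\dots,\delta_r+\delta_{r+1}$. *)

(* Defs.v *)
From mathcomp Require Import all_boot all_order all_algebra all_field.
Set Implicit Arguments. Unset Strict Implicit. Unset Printing Implicit Defensive.
Import Order.TTheory GRing.Theory Num.Theory.
Local Open Scope ring_scope.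

(* Working in algC (algebraic complex numbers).
   p.-root (-1) is the p-th root of -1 of minimal non-negative argument,
   i.e. exp(i pi / p); its square is zeta_p = exp(2 pi i / p). *)
Definition zeta (p : nat) : algC := (p.-root (-1)) ^+ 2.

Definition gauss_sqrt (p : nat) : algC := \sum_(x < p) zeta p ^+ (x ^ 2)%N.

Definition half_r (p : nat) : nat := p.-1./2.

(* Q(x) = a x^2 / p, so exp(2 pi i Q(j)) = zeta^(a j^2) and
   B(j,k) = 2 a j k / p, so exp(+-2 pi i B(j,k)) = zeta^(+-2 a j k). *)
Definition thetaQ (p a j : nat) : algC := zeta p ^+ (a * j ^ 2)%N.

Definition Smat (p a : nat) : 'M[algC]_((half_r p).+1) :=
  \matrix_(j, k)
    if k == ord0 then (gauss_sqrt p)^-1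
    else if j == ord0 then 2 / gauss_sqrt p
    else (zeta p ^- (2 * a * j * k)%N + zeta p ^+ (2 * a * j * k)%N) / gauss_sqrt p.

Definition VQ (p a : nat) : 'M[algC]_((half_r p).+1) :=
  \matrix_(j, k) thetaQ p a j ^+ k.

Definition Sprime (p a : nat) : 'M[algC]_((half_r p).+1) :=
  invmx (VQ p a) *m Smat p a *m VQ p a.

Definition in_Zadj (alpha x : algC) : Prop :=
  exists P : {poly int}, x = (map_poly (fun z : int => z%:~R) P).[alpha].

Definition qnr (p c : nat) : Prop := forall x : nat, ((x ^ 2) %% p != c %% p)%N.

(* Main.v *)
(* Write e(y) = zeta^y on F_p, g for the Gauss sum, O = Z[(1 + g) / 2], and
   theta_j = e(a j^2).  An element of Z[zeta] fixed by every automorphism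
   zeta |-> zeta^(t^2) lies in O, because e(y), y <> 0, are linearly independent.
   This applies to the coefficients of f = \prod_j ('X - theta_j) and to the
   inverse of its constant term.  As f is monic, every power theta^m is an
   O-combination of the columns theta^0, ..., theta^r of V.  For m prime to p,
   completing the square gives S theta^m = +- theta^(-1/m), while S theta^0 is
   reached from S theta^1, ..., S theta^(r+1) through the relation f(theta) = 0,
   whose constant coefficient is a unit of O.  Hence S V = V U with U over O. *)
Require Import Defs.
From mathcomp Require Import all_boot all_order all_algebra all_field.
From mathcomp Require Import ring zify.
Set Implicit Arguments. Unset Strict Implicit. Unset Printing Implicit Defensive.
Import GRing.Theory Num.Theory.
Local Open Scope ring_scope.

Lemma zeta_prim (p : nat) : prime p -> odd p -> p.-primitive_root (zeta p).
Proof.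
move=> p_pr p_odd; have p_gt0 := prime_gt0 p_pr.
have zp1 : zeta p ^+ p = 1.
  by rewrite /zeta exprAC rootCK // sqrrN expr1n.
have [m prim_m m_dvd] := prim_order_exists p_gt0 zp1.
have [_ /(_ m m_dvd) /pred2P[m_eq|m_eq]] := primeP p_pr; last by rewrite -{1}m_eq.
(* Order 1 would make [p.-root (-1)] equal to 1 or -1. Its [p]-th power excludes 1, and a principal
   root of degree above 1 is never negative. *)
have /eqP := prim_expr_order prim_m; rewrite m_eq expr1 /zeta sqrf_eq1.
rewrite rootC_eq1 // eqNr oner_eq0 /= => /eqP root_eq.
by have := rootC_lt0 (-1 : algC) (prime_gt1 p_pr); rewrite root_eq ltrN10.
Qed.

(** * Sums over ['F_p] and over its squares *)

Section QuadraticSums.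

Variable p : nat.
Hypotheses (p_pr : prime p) (p_odd : odd p).

Lemma odd_half_r : p = (half_r p + half_r p).+1.
Proof.
rewrite /half_r addnn -[LHS]prednK ?prime_gt0 //; congr _.+1.
by rewrite -[LHS]odd_double_half -subn1 oddB ?prime_gt0 // p_odd.
Qed.

Lemma big_Fp_nat (R : Type) (idx : R) (op : R -> R -> R) (F : 'F_p -> R) :
  \big[op/idx]_(x : 'F_p) F x = \big[op/idx]_(0 <= i < p) F i%:R.
Proof.
transitivity (\big[op/idx]_(0 <= i < (Zp_trunc (pdiv p)).+2) F i%:R).
  by rewrite big_mkord; apply: eq_bigr => i _; rewrite natr_Zp.
by rewrite Fp_cast.
Qed.

Lemma big_Fp_half (R : Type) (idx : R) (op : Monoid.com_law idx) (F : 'F_p -> R) :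
  \big[op/idx]_x F x =
  op (F 0) (\big[op/idx]_(j < half_r p) op (F j.+1%:R) (F (- j.+1%:R))).
Proof.
rewrite big_Fp_nat {1}odd_half_r big_nat_recl //.
rewrite (@big_cat_nat _ _ _ (half_r p)) ?leq_addr //=.
rewrite big_split /= mulr0n; congr (op _ (op _ _)); first by rewrite big_mkord.
(* Read backwards, the upper half of the residues is [- j.+1]. *)
rewrite -{1}[half_r p]add0n big_addn addnK big_nat_rev big_mkord.
apply: eq_bigr => j _; congr F; apply/eqP.
rewrite -subr_eq0 opprK -natrD /= add0n.
have -> : ((half_r p - j.+1 + half_r p).+1 + j.+1)%N = p.
  by have := odd_half_r; have := ltn_ord j; lia.
by rewrite pchar_Fp_0 //.
Qed.

Definition sqrt_count (y : 'F_p) := #|[pred x : 'F_p | x ^+ 2 == y]|.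

Lemma sum_sqr (V : zmodType) (F : 'F_p -> V) :
  \sum_x F (x ^+ 2) = \sum_y F y *+ sqrt_count y.
Proof.
rewrite (partition_big (fun x : 'F_p => x ^+ 2) predT) //=.
by apply: eq_bigr => y _; rewrite -sumr_const; apply: eq_bigr => x /eqP ->.
Qed.

Lemma sqrt_count_le2 y : (sqrt_count y <= 2)%N.
Proof.
rewrite /sqrt_count; have [x /eqP <-|no_x] := pickP [pred x : 'F_p | x ^+ 2 == y].
  apply: leq_trans (card_size [:: x; - x]).
  by apply/subset_leq_card/subsetP => w; rewrite !inE eqf_sqr.
by rewrite eq_card0.
Qed.

Lemma sqrt_count0 : sqrt_count 0 = 1%N.
Proof.
by rewrite -(card1 (0 : 'F_p)); apply: eq_card => x; rewrite !inE sqrf_eq0.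
Qed.

Lemma sum_sqrt_count : (\sum_y sqrt_count y)%N = p.
Proof.
rewrite -[RHS](card_Fp p_pr) -sum1_card.
rewrite [RHS](partition_big (fun x : 'F_p => x ^+ 2) predT) //=.
by apply: eq_bigr => y _; rewrite sum1_card.
Qed.

(* Each summand is at most 2, since n is not a square, and the sum over y is 2p. *)
Lemma sqrt_count_nonsquare (n y : 'F_p) : (forall x, x ^+ 2 != n) ->
  (sqrt_count y + sqrt_count (y / n))%N = 2.
Proof.
move=> n_nsq.
have n_neq0 : n != 0 by have := n_nsq 0; rewrite expr0n eq_sym.
have le2 w : (sqrt_count w + sqrt_count (w / n) <= 2)%N.
  have [->|w_neq0] := eqVneq w 0; first by rewrite mul0r sqrt_count0.
  have [/= x /eqP xw|no_x] := pickP [pred x : 'F_p | x ^+ 2 == w]; last first.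
    by rewrite {1}/sqrt_count eq_card0 // sqrt_count_le2.
  have [/= x' /eqP xw'|no_x'] := pickP [pred x : 'F_p | x ^+ 2 == w / n]; last first.
    by rewrite {2}/sqrt_count (eq_card0 no_x') // addn0 sqrt_count_le2.
  (* If [w] and [w / n] were both squares, so would be their quotient [n]. *)
  case/eqP: (n_nsq (x / x')); rewrite expr_div_n xw xw'.
  by rewrite invf_div mulrCA mulfV ?mulr1.
have sum_shift : (\sum_w sqrt_count (w / n))%N = p.
  rewrite -[RHS]sum_sqrt_count [RHS](reindex (fun w => w / n)) //=.
  by exists (fun w => w * n) => w _; rewrite ?mulfK ?divfK.
have [_] := leqif_sum (fun w (_ : true) => leqif_eq (le2 w)).
rewrite big_split /= sum_sqrt_count sum_shift sum_nat_const card_Fp // muln2 addnn eqxx.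
by move/esym/forallP/(_ y)/eqP.
Qed.

(** The values [x ^+ 2] and [n * x ^+ 2] together meet every residue exactly twice. *)
Lemma sum_sqr_nonsquare (V : zmodType) (F : 'F_p -> V) (n : 'F_p) :
  (forall x, x ^+ 2 != n) ->
  \sum_x F (x ^+ 2) + \sum_x F (n * x ^+ 2) = (\sum_y F y) *+ 2.
Proof.
move=> n_nsq.
have n_neq0 : n != 0 by have := n_nsq 0; rewrite expr0n eq_sym.
rewrite sum_sqr (sum_sqr (fun y => F (n * y))).
rewrite [X in _ + X](reindex (fun w => w / n)) /=; last first.
  by exists (fun w => w * n) => w _; rewrite ?mulfK ?divfK.
rewrite -big_split -sumrMnl; apply: eq_bigr => y _ /=.
by rewrite mulrC divfK // -mulrnDr sqrt_count_nonsquare.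
Qed.

End QuadraticSums.

(** * Closure properties of Z[alpha] *)

Section IntegralAdjunction.

Variable alpha : algC.

Lemma in_Zadj_int (m : int) : in_Zadj alpha m%:~R.
Proof. by exists m%:P; rewrite map_polyC hornerC. Qed.

Lemma in_Zadj_gen : in_Zadj alpha alpha.
Proof. by exists 'X; rewrite map_polyX hornerX. Qed.

Lemma in_ZadjD x y : in_Zadj alpha x -> in_Zadj alpha y -> in_Zadj alpha (x + y).
Proof. by move=> [P ->] [Q ->]; exists (P + Q); rewrite rmorphD hornerD. Qed.

Lemma in_ZadjM x y : in_Zadj alpha x -> in_Zadj alpha y -> in_Zadj alpha (x * y).
Proof. by move=> [P ->] [Q ->]; exists (P * Q); rewrite rmorphM hornerM. Qed.

Lemma in_ZadjN x : in_Zadj alpha x -> in_Zadj alpha (- x).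
Proof. by move=> [P ->]; exists (- P); rewrite rmorphN hornerN. Qed.

Lemma in_ZadjX x n : in_Zadj alpha x -> in_Zadj alpha (x ^+ n).
Proof. by move=> [P ->]; exists (P ^+ n); rewrite rmorphXn horner_exp. Qed.

Lemma in_Zadj_prod (I : Type) (s : seq I) (P : pred I) (F : I -> algC) :
  (forall i, in_Zadj alpha (F i)) -> in_Zadj alpha (\prod_(i <- s | P i) F i).
Proof.
move=> inF; elim/big_ind: _ => // [|x y]; last exact: in_ZadjM.
exact: in_Zadj_int 1.
Qed.

Lemma in_Zadj_coef_prod (n : nat) (F : 'I_n -> algC) k :
  (forall i, in_Zadj alpha (F i)) ->
  in_Zadj alpha (\prod_(i < n) ('X - (F i)%:P))`_k.
Proof.
elim: n F k => [|n IHn] F k inF.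
  rewrite big_ord0 coef1.
  by case: eqP => _; [exact: in_Zadj_int 1 | exact: in_Zadj_int 0].
rewrite big_ord_recl mulrBl coefB coefXM coefCM.
apply: in_ZadjD; last by apply: in_ZadjN; apply: in_ZadjM; last apply: IHn.
by case: eqP => _; [exact: (in_Zadj_int 0) | apply: IHn].
Qed.

End IntegralAdjunction.

(** * Characters of ['F_p], Gauss sums and Galois invariants *)

Section GaussSums.

Variables (p : nat) (z : algC).
Hypotheses (p_pr : prime p) (p_odd : odd p) (z_prim : p.-primitive_root z).

Definition addchar (x : 'F_p) : algC := z ^+ x.

Lemma addchar_nat n : addchar n%:R = z ^+ n.
Proof. by rewrite /addchar val_Fp_nat // prim_expr_mod. Qed.

Lemma addcharD x y : addchar (x + y) = addchar x * addchar y.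
Proof. by rewrite -(natr_Zp x) -(natr_Zp y) -natrD !addchar_nat exprD. Qed.

Lemma addchar0 : addchar 0 = 1.
Proof. by rewrite -[0]/(0%:R) addchar_nat. Qed.

Lemma addcharX x n : addchar x ^+ n = addchar (n%:R * x).
Proof. by rewrite -{1 2}(natr_Zp x) -natrM !addchar_nat -exprM mulnC. Qed.

Lemma addchar_neq0 x : addchar x != 0.
Proof. by rewrite expf_neq0 // (prim_root_eq0 z_prim) -lt0n prime_gt0. Qed.

Lemma addcharN x : addchar (- x) = (addchar x)^-1.
Proof.
apply: (mulfI (addchar_neq0 x)).
by rewrite -addcharD subrr addchar0 mulfV ?addchar_neq0.
Qed.

Lemma addchar_inj : injective addchar.
Proof.
move=> x y /eqP; rewrite (eq_prim_root_expr z_prim) => /eqP xy.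
by rewrite -(natr_Zp x) -(natr_Zp y) -(Fp_nat_mod p_pr x) xy Fp_nat_mod.
Qed.

Lemma sum_addchar : \sum_x addchar x = 0.
Proof.
have addchar1 : addchar 1 != 1.
  by rewrite -addchar0 (inj_eq addchar_inj) oner_eq0.
apply: (mulfI (_ : addchar 1 - 1 != 0)); first by rewrite subr_eq0.
rewrite mulr0 mulrBl mul1r mulr_sumr; apply/eqP; rewrite subr_eq0; apply/eqP.
rewrite [RHS](reindex_inj (addrI 1)).
by apply: eq_bigr => x _; rewrite addcharD.
Qed.

Lemma addchar_aut t : t != 0 ->
  exists u : {rmorphism algC -> algC}, forall x, u (addchar x) = addchar (t * x).
Proof.
move=> t_neq0; have co_t_p : coprime t p.
  rewrite coprime_sym prime_coprime //; apply: contra t_neq0.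
  by rewrite (dvdn_pcharf (pchar_Fp p_pr)) natr_Zp.
have [u uE] := Qn_aut_exists co_t_p; exists u => x.
by rewrite uE ?addcharX ?natr_Zp // pchar_Fp_0 // mul0r addchar0.
Qed.

(* The minimal polynomial of z has degree p - 1. *)
Lemma addchar_indep (c : 'F_p -> int) :
  \sum_x (c x)%:~R * addchar x = 0 -> forall x, c x = c 0.
Proof.
move=> c0; have p_gt0 := prime_gt0 p_pr.
suff c_last x : c x = c p.-1%:R by move=> x; rewrite [LHS]c_last [RHS]c_last.
(* Subtracting [c p.-1%:R] times the vanishing sum of all characters removes the term of exponent
   [p.-1], so [q] has smaller degree than the minimal polynomial of [z]. *)
pose q : {poly rat} := \poly_(i < p.-1) (c i%:R - c p.-1%:R)%:~R.
have [m [m_min _ m_dvd]] := minCpolyP z.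
have size_m : size m = p.
  rewrite -(size_map_poly (ratr : rat -> algC)) -m_min.
  by rewrite (minCpoly_cyclotomic z_prim) size_cyclotomic totient_prime // prednK.
have q_root : root (map_poly ratr q) z.
  rewrite /root /q poly_def rmorph_sum horner_sum.
  under eq_bigr do
    rewrite /= map_polyZ map_polyXn hornerZ hornerXn /= ratr_int -addchar_nat.
  have : \sum_x (c x - c p.-1%:R)%:~R * addchar x = 0.
    under eq_bigr do rewrite rmorphB mulrBl.
    by rewrite sumrB c0 -mulr_sumr sum_addchar mulr0 subrr.
  rewrite big_Fp_nat // -[X in \sum_(0 <= _ < X) _](prednK p_gt0) big_nat_recr //=.
  by rewrite subrr mul0r addr0 big_mkord => ->.
have q0 : q = 0.
  apply/eqP; apply: contraTT q_root => q_neq0; rewrite m_dvd.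
  apply/negP => /(dvdp_leq q_neq0); rewrite size_m leqNgt.
  by rewrite (leq_ltn_trans (size_poly _ _)) // prednK.
have := congr1 (fun q : {poly rat} => q`_x) q0; rewrite coef0 coef_poly natr_Zp.
case: ltnP => [_ /eqP|x_ge _]; first by rewrite intr_eq0 subr_eq0 => /eqP.
congr c; rewrite -[LHS]natr_Zp; congr _%:R; apply/eqP; rewrite eqn_leq x_ge andbT.
by rewrite -ltnS prednK // -[X in (_ < X)%N](Fp_cast p_pr) ltn_ord.
Qed.

Lemma in_Zadj_addchar x : in_Zadj z x ->
  exists c : 'F_p -> int, x = \sum_y (c y)%:~R * addchar y.
Proof.
move=> [P ->]; exists (fun y => \sum_(i < size P | i%:R == y) P`_i).
rewrite horner_coef size_map_inj_poly //; last first.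
  by move=> m n /eqP; rewrite eqr_int => /eqP.
rewrite (partition_big (fun i : 'I__ => i%:R : 'F_p) predT) //=.
apply: eq_bigr => y _; rewrite rmorph_sum mulr_suml.
by apply: eq_bigr => i /eqP <-; rewrite coef_map addchar_nat.
Qed.

Definition gauss (m : 'F_p) := \sum_x addchar (m * x ^+ 2).

Lemma gauss_sqr_mul (t m : 'F_p) : t != 0 -> gauss (t ^+ 2 * m) = gauss m.
Proof.
move=> t_neq0; rewrite [RHS](reindex_inj (mulfI t_neq0)).
by apply: eq_bigr => x _; congr addchar; ring.
Qed.

Lemma gauss_nonsquare (n : 'F_p) : (forall x, x ^+ 2 != n) -> gauss n = - gauss 1.
Proof.
move=> n_nsq; apply/eqP; rewrite -addr_eq0 addrC /gauss.
under eq_bigr do rewrite mul1r.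
by rewrite (sum_sqr_nonsquare p_pr) // sum_addchar mul0rn.
Qed.

Lemma gauss_pm m : m != 0 -> gauss m = gauss 1 \/ gauss m = - gauss 1.
Proof.
move=> m_neq0.
have [/existsP[t /eqP tm]|] := boolP [exists t : 'F_p, t ^+ 2 == m].
  left; rewrite -tm -(mulr1 (t ^+ 2)) gauss_sqr_mul //.
  by apply: contra m_neq0 => /eqP t0; rewrite -tm t0 expr0n.
by rewrite negb_exists => /forallP m_nsq; right; exact: gauss_nonsquare.
Qed.

Definition quad_gen := (1 + gauss 1) / 2.

(** Invariance makes the coefficients of [x] constant on nonzero squares and on nonsquares, so only
    1 and two Gaussian periods remain. *)
Lemma in_Zadj_fixed (x : algC) (n : 'F_p) :
  (forall w : 'F_p, w ^+ 2 != n) -> in_Zadj z x ->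
  (forall (t : 'F_p) (u : {rmorphism algC -> algC}), t != 0 ->
     (forall y, u (addchar y) = addchar (t ^+ 2 * y)) -> u x = x) ->
  in_Zadj quad_gen x.
Proof.
move=> n_nsq /in_Zadj_addchar[c xE] x_fix.
have c_sqr t y : t != 0 -> c (t ^+ 2 * y) = c y.
  move=> t_neq0; have t2_neq0 : t ^+ 2 != 0 by rewrite expf_neq0.
  have [u uE] := addchar_aut t2_neq0; have := x_fix t u t_neq0 uE.
  rewrite xE rmorph_sum => /eqP; rewrite -subr_eq0.
  under eq_bigr do rewrite rmorphM rmorph_int uE.
  rewrite [X in _ - X](reindex_inj (mulfI t2_neq0)) -sumrB => /eqP.
  under eq_bigr do rewrite -mulrBl -rmorphB.
  move=> sum0.
  (* The coefficients of [u x - x]; independence makes [d] constant, and [d 0 = 0]. *)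
  pose d w := c (w / t ^+ 2) - c w.
  have /addchar_indep/(_ (t ^+ 2 * y)) : \sum_w (d w)%:~R * addchar w = 0.
    rewrite (reindex_inj (mulfI t2_neq0)) -[RHS]sum0.
    by apply: eq_bigr => w _; rewrite /d mulrAC mulfV ?mul1r.
  rewrite /d mul0r subrr mulrAC mulfV // mul1r => /eqP.
  by rewrite subr_eq0 => /eqP.
(* The term at [w = 0] carries [c 0] instead of [c m], hence the correction. *)
have sum_c m : \sum_w (c (m * w ^+ 2))%:~R * addchar (m * w ^+ 2)
    = (c m)%:~R * gauss m + (c 0 - c m)%:~R.
  rewrite mulr_sumr (bigD1 (0 : 'F_p)) //= [X in _ = X + _](bigD1 (0 : 'F_p)) //=.
  rewrite expr0n mulr0 addchar0 !mulr1.
  rewrite [RHS]addrAC -rmorphD [c m + _]addrC subrK; congr (_ + _).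
  by apply: eq_bigr => w w_neq0; rewrite [m * _]mulrC c_sqr.
have := sum_sqr_nonsquare p_pr (fun y => (c y)%:~R * addchar y) n_nsq.
rewrite -xE sum_c (gauss_nonsquare n_nsq).
under eq_bigr do rewrite -[_ ^+ 2]mul1r.
rewrite sum_c => x2.
(* The characters sum to [(gauss 1 - 1) / 2] over nonzero squares and to [(- gauss 1 - 1) / 2] over
   nonsquares. *)
have -> : x = (c 0 - c 1)%:~R + (c 1 - c n)%:~R * quad_gen.
  apply: (mulIf (_ : 2 != 0)); first by rewrite pnatr_eq0.
  by rewrite mulr_natr -x2 /quad_gen !rmorphB /=; field.
by apply: in_ZadjD; [|apply: in_ZadjM; last exact: in_Zadj_gen]; exact: in_Zadj_int.
Qed.

(** * The nodes theta_j and the action of S on their powers *)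

Section Conjugation.

Variables a nsq : 'F_p.
Hypotheses (a_neq0 : a != 0) (nsqP : forall x : 'F_p, x ^+ 2 != nsq).

Local Notation r := (half_r p).

Definition node (j : nat) : algC := addchar (a * j%:R ^+ 2).

Definition node_poly : {poly algC} := \prod_(j < r.+1) ('X - (node j)%:P).

(** Equal nodes force [j = k] or [j = - k] mod [p]; as [j + k < p], the latter leaves only
    [j = k = 0]. *)
Lemma node_inj (j k : 'I_r.+1) : node j = node k -> j = k.
Proof.
move=> /addchar_inj /(mulfI a_neq0) /eqP; rewrite eqf_sqr => jk.
have pE := odd_half_r p_pr p_odd; have [j_le k_le] := (ltn_ord j, ltn_ord k).
apply: val_inj; move: jk => /orP[/eqP jk|].
  have := congr1 (@nat_of_ord _) jk.
  by rewrite !val_Fp_nat // !modn_small //; lia.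
rewrite -subr_eq0 opprK -natrD -(dvdn_pcharf (pchar_Fp p_pr)).
by move/dvdnP=> [[|m]] /=; lia.
Qed.

(** The product over ['F_p] meets each node with [j > 0] twice, at [j] and [- j], but the node 1 of
    [j = 0] only once; ['X - 1] supplies its second copy. *)
Lemma node_poly_sqr :
  node_poly ^+ 2 = ('X - 1) * \prod_x ('X - (addchar (a * x ^+ 2))%:P).
Proof.
rewrite (big_Fp_half p_pr p_odd) /= mulrA expr0n mulr0 addchar0 -expr2.
rewrite /node_poly big_ord_recl /node expr0n mulr0 addchar0 exprMn -prodrXl.
by congr (_ * _); apply: eq_bigr => j _; rewrite sqrrN expr2.
Qed.

Lemma node_poly_monic : node_poly \is monic.
Proof. exact: monic_prod_XsubC. Qed.

Lemma size_node_poly : size node_poly = r.+2.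
Proof. by rewrite size_prod_XsubC /index_enum -enumT size_enum_ord. Qed.

(* The square of node_poly is visibly invariant, which fixes it up to a sign. *)
Lemma node_poly_fixed t (u : {rmorphism algC -> algC}) : t != 0 ->
  (forall y, u (addchar y) = addchar (t ^+ 2 * y)) -> map_poly u node_poly = node_poly.
Proof.
move=> t_neq0 uE.
have : map_poly u node_poly ^+ 2 == node_poly ^+ 2.
  apply/eqP; rewrite -rmorphXn node_poly_sqr rmorphM rmorphB /= map_polyX rmorph1.
  congr (_ * _); rewrite rmorph_prod [RHS](reindex_inj (mulfI t_neq0)).
  apply: eq_bigr => x _; rewrite rmorphB /= map_polyX map_polyC /= uE.
  by congr ('X - (addchar _)%:P); ring.
(* Both polynomials are monic, which rules out the sign -1. *)
rewrite eqf_sqr => /orP[/eqP //|/eqP /(congr1 lead_coef)/eqP].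
rewrite lead_coef_map lead_coefN (monicP node_poly_monic) rmorph1.
by rewrite -addr_eq0 -[1 + 1]/(2%:R) pnatr_eq0.
Qed.

Lemma in_Zadj_addchar_val y : in_Zadj z (addchar y).
Proof. by apply: in_ZadjX; exact: in_Zadj_gen. Qed.

Lemma in_Zadj_node_coef k : in_Zadj quad_gen node_poly`_k.
Proof.
apply: (in_Zadj_fixed nsqP) => [|t u t_neq0 uE].
  by apply: in_Zadj_coef_prod => j; exact: in_Zadj_addchar_val.
by rewrite -coef_map (node_poly_fixed t_neq0 uE).
Qed.

Lemma node_coef0 : node_poly`_0 = \prod_(j < r.+1) - node j.
Proof.
rewrite -horner_coef0 horner_prod.
by apply: eq_bigr => j _; rewrite hornerXsubC sub0r.
Qed.

Lemma node_coef0_neq0 : node_poly`_0 != 0.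
Proof.
by rewrite node_coef0; apply/prodf_neq0 => j _; rewrite oppr_eq0 addchar_neq0.
Qed.

(** The inverse of a character value is again one, so this inverse lies in Z[z] and inherits the
    invariance. *)
Lemma in_Zadj_node_coef0V : in_Zadj quad_gen (node_poly`_0)^-1.
Proof.
apply: (in_Zadj_fixed nsqP) => [|t u t_neq0 uE].
  rewrite node_coef0 -prodfV; apply: in_Zadj_prod => j.
  by rewrite invrN -addcharN; apply: in_ZadjN; exact: in_Zadj_addchar_val.
by rewrite fmorphV -coef_map (node_poly_fixed t_neq0 uE).
Qed.

Lemma node_poly_root (x : 'F_p) :
  \sum_(k < r.+2) node_poly`_k * addchar (a * x ^+ 2) ^+ k = 0.
Proof.
rewrite -size_node_poly -horner_coef; apply/eqP.
rewrite -sqrf_eq0 -horner_exp node_poly_sqr hornerM mulf_eq0 horner_prod.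
apply/orP; right.
by rewrite (bigD1 x) //= hornerXsubC subrr mul0r.
Qed.

(** Membership in the O-module generated by the columns of V; the [c k] will form a column of U. *)
Definition in_span (phi : 'I_r.+1 -> algC) : Prop :=
  exists2 c : 'I_r.+1 -> algC, forall k, in_Zadj quad_gen (c k) &
    forall j, phi j = \sum_k c k * node j ^+ k.

Lemma in_span_ext phi psi : (forall j, phi j = psi j) -> in_span psi -> in_span phi.
Proof. by move=> eq_phi [c Oc cE]; exists c => // j; rewrite eq_phi. Qed.

Lemma in_spanZ b phi : in_Zadj quad_gen b -> in_span phi ->
  in_span (fun j => b * phi j).
Proof.
move=> Ob [c Oc cE]; exists (fun k => b * c k) => [k|j]; first exact: in_ZadjM.
by rewrite cE mulr_sumr; apply: eq_bigr => k _; rewrite mulrA.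
Qed.

Lemma in_span_sum n (phi : 'I_n -> 'I_r.+1 -> algC) : (forall i, in_span (phi i)) ->
  in_span (fun j => \sum_i phi i j).
Proof.
elim: n phi => [|n IHn] phi spanP.
  exists (fun=> 0) => [k|j]; first exact: in_Zadj_int 0.
  by rewrite big_ord0 big1 // => k _; rewrite mul0r.
have [[c Oc cE] [d Od dE]] := (spanP ord0, IHn _ (fun i => spanP (lift ord0 i))).
exists (fun k => c k + d k) => [k|j]; first exact: in_ZadjD.
rewrite big_ord_recl cE dE -big_split.
by apply: eq_bigr => k _; rewrite mulrDl.
Qed.

Lemma in_span_exp m : in_span (fun j => node j ^+ m).
Proof.
elim/ltn_ind: m => m IHm; case: (ltnP m r.+1) => [m_lt|m_ge].
  exists (fun k => (k == Ordinal m_lt)%:R) => [k|j].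
    by case: eqP => _; [exact: in_Zadj_int 1 | exact: in_Zadj_int 0].
  rewrite (bigD1 (Ordinal m_lt)) //= eqxx mul1r big1 ?addr0 // => k /negPf->.
  by rewrite mul0r.
(* The relation f(theta_j) = 0, multiplied by [node j ^+ (m - r.+1)], lowers the exponent. *)
apply: (@in_span_ext _ (fun j =>
  \sum_(k < r.+1) (- node_poly`_k) * node j ^+ (k + (m - r.+1)))).
  move=> j; have := node_poly_root j%:R; rewrite -/(node j) big_ord_recr /=.
  have -> : node_poly`_r.+1 = 1.
    by rewrite -[r.+1]/(r.+2.-1) -size_node_poly; exact/monicP/node_poly_monic.
  rewrite mul1r => /eqP; rewrite addrC addr_eq0 => /eqP top.
  rewrite -{1}(subnKC m_ge) exprD top -sumrN mulr_suml.
  by apply: eq_bigr => k _; rewrite exprD !mulNr mulrA.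
apply: in_span_sum => k; apply: in_spanZ; first exact/in_ZadjN/in_Zadj_node_coef.
by apply: IHm; have := ltn_ord k; lia.
Qed.

(* The value at j of S applied to the vector of m-th powers of the nodes. *)
Definition weil_image (m : nat) (j : 'I_r.+1) : algC :=
  (gauss 1)^-1 * \sum_x addchar (a * (m%:R * x ^+ 2 - 2 * j%:R * x)).

Lemma weil_image_unit m : (m%:R : 'F_p) != 0 -> in_span (weil_image m).
Proof.
move=> m_neq0; have [s sE] : exists s : 'F_p, s = - m%:R^-1 by eexists.
apply: (@in_span_ext _ (fun j => (gauss 1)^-1 * gauss (a * m%:R) * node j ^+ s)).
  move=> j; rewrite -mulrA; congr (_ * _).
  (* The shift by [j / m] completes the square and leaves the constant [- a * j ^ 2 / m], that is,
     the exponent [s]. *)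
  rewrite (reindex_inj (addrI (j%:R / m%:R))) mulr_suml /=.
  apply: eq_bigr => x _; rewrite /node addcharX natr_Zp -addcharD; congr addchar.
  by rewrite sE; field.
apply: in_spanZ; last exact: in_span_exp.
(* A zero [gauss 1] has inverse 0 and gives the scalar 0; otherwise the scalar is 1 or -1. *)
have [g0|g_neq0] := eqVneq (gauss 1) 0.
  by rewrite g0 invr0 mul0r; exact: in_Zadj_int 0.
have [->|->] := gauss_pm (mulf_neq0 a_neq0 m_neq0); rewrite ?mulrN mulVf //.
  exact: in_Zadj_int 1.
exact: in_Zadj_int (-1).
Qed.

(* Every [addchar (a * x ^+ 2)] is a root of [node_poly], so the images of the
   powers [0 .. r + 1] satisfy the linear relation given by its coefficients,
   whose constant one is a unit. *)
Lemma weil_image0 j :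
  weil_image 0 j =
  - (node_poly`_0)^-1 * \sum_(k < r.+1) node_poly`_k.+1 * weil_image k.+1 j.
Proof.
have rel : \sum_(k < r.+2) node_poly`_k * weil_image k j = 0.
  under eq_bigr do rewrite /weil_image mulrCA mulr_sumr.
  rewrite -mulr_sumr exchange_big /= big1 ?mulr0 // => x _.
  (* For fixed [x] the factor linear in [x] is independent of [k]; what remains is f evaluated at
     one of its roots. *)
  transitivity (addchar (a * (- (2 * j%:R * x))) *
      \sum_(k < r.+2) node_poly`_k * addchar (a * x ^+ 2) ^+ k); last first.
    by rewrite node_poly_root mulr0.
  rewrite mulr_sumr; apply: eq_bigr => k _.
  by rewrite [RHS]mulrCA addcharX -addcharD; congr (_ * addchar _); ring.
move/eqP: rel; rewrite big_ord_recl /= addr_eq0 => /eqP rel.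
by apply: (mulfI node_coef0_neq0); rewrite rel mulNr mulrN mulVKf ?node_coef0_neq0.
Qed.

Lemma weil_image_span m : (m <= r)%N -> in_span (weil_image m).
Proof.
have pE := odd_half_r p_pr p_odd; have p_gt1 := prime_gt1 p_pr.
(* The relation for [m = 0] reaches the index [r + 1], which is still below [p]. *)
have natS_neq0 k : (k <= r)%N -> (k.+1%:R : 'F_p) != 0.
  by move=> k_le; rewrite -(dvdn_pcharf (pchar_Fp p_pr)) gtnNdvd //; lia.
case: m => [_|m m_lt]; last by apply: weil_image_unit; exact/natS_neq0/ltnW.
apply: (in_span_ext weil_image0); apply: in_spanZ.
  exact/in_ZadjN/in_Zadj_node_coef0V.
apply: in_span_sum => k; apply: in_spanZ; first exact: in_Zadj_node_coef.
by apply/weil_image_unit/natS_neq0; rewrite -ltnS.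
Qed.

End Conjugation.

End GaussSums.

(* Q = Q_1 (a = 1) or Q = Q_2 (a = c, c a quadratic non-residue mod p) *)
Theorem theorem3 (p c a : nat) :
  prime p -> odd p -> qnr p c -> (a = 1%N \/ a = c) ->
  forall j k : 'I_((half_r p).+1),
    in_Zadj ((1 + gauss_sqrt p) / 2) (Sprime p a j k).
Proof.
move=> p_pr p_odd c_qnr aE; have z_prim := zeta_prim p_pr p_odd.
have c_nsq (x : 'F_p) : x ^+ 2 != c%:R.
  apply: contra (c_qnr x) => /eqP xc.
  by rewrite -!val_Fp_nat // -xc natrX natr_Zp.
have a_neq0 : (a%:R : 'F_p) != 0.
  case: aE => ->; first by rewrite oner_neq0.
  by have := c_nsq 0; rewrite expr0n eq_sym.
have gaussE : gauss_sqrt p = gauss (zeta p) (1 : 'F_p).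
  rewrite /gauss_sqrt -(big_mkord xpredT (fun x => zeta p ^+ (x ^ 2))).
  rewrite /gauss big_Fp_nat //; apply: eq_bigr => x _.
  by rewrite mul1r -natrX addchar_nat.
have thetaE j : thetaQ p a j = node (zeta p) (a%:R : 'F_p) j.
  by rewrite /node -natrX -natrM addchar_nat.
have V_unit : VQ p a \in unitmx.
  pose v := \row_(j < (half_r p).+1) thetaQ p a j.
  have -> : VQ p a = (Vandermonde _ v)^T by apply/matrixP => i j; rewrite !mxE.
  rewrite unitmx_tr unitmxE det_Vandermonde unitfE.
  apply/prodf_neq0 => i _; apply/prodf_neq0 => j lt_ij.
  rewrite !mxE subr_eq0 !thetaE; apply: contraTneq lt_ij.
  by move/(node_inj p_pr p_odd z_prim a_neq0) ->; rewrite ltnn.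
(* Column 0 of S accounts for [x = 0] and column [l > 0] for the pair [l], [- l], so the product
   unfolds to a sum over all of ['F_p]. *)
have SVE j k : (Smat p a *m VQ p a) j k = weil_image (zeta p) (a%:R : 'F_p) k j.
  rewrite mxE /weil_image (big_Fp_half p_pr p_odd) /= mulrDr big_ord_recl !mxE eqxx.
  congr (_ + _).
    rewrite gaussE thetaE /node !expr0n !mulr0 subrr mulr0.
    by rewrite !addchar0 // expr1n.
  rewrite mulr_sumr; apply: eq_bigr => l _; rewrite !mxE gaussE thetaE lift0 /=.
  set y : 'F_p := l.+1%:R.
  have -> : a%:R * (k%:R * y ^+ 2 - 2 * j%:R * y)
      = k%:R * (a%:R * y ^+ 2) - (2 * a * j * l.+1)%:R :> 'F_p.
    by rewrite !natrM -/y; ring.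
  have -> : a%:R * (k%:R * (- y) ^+ 2 - 2 * j%:R * - y)
      = k%:R * (a%:R * y ^+ 2) + (2 * a * j * l.+1)%:R :> 'F_p.
    by rewrite !natrM -/y; ring.
  rewrite !addcharD // addcharN // addchar_nat // -addcharX // -/(node _ _ _).
  (* In row 0 both characters equal 1, which matches the entry [2 / gauss_sqrt p]. *)
  case: eqP => [->|_]; last by ring.
  by rewrite muln0 mul0n expr0 invr1; ring.
move=> j k; rewrite gaussE.
have [U OU UE] : exists2 U : 'M[algC]_((half_r p).+1),
    forall i l, in_Zadj (quad_gen p (zeta p)) (U i l) &
    Smat p a *m VQ p a = VQ p a *m U.
  have spanP (l : 'I_(half_r p).+1) :=
    weil_image_span p_pr p_odd z_prim a_neq0 c_nsq (ltn_ord l).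
  have /fin_all_exists2[u Ou uE] := spanP.
  exists (\matrix_(i, l) u l i) => [i l|]; first by rewrite mxE.
  apply/matrixP => i l; rewrite SVE uE mxE.
  by apply: eq_bigr => m _; rewrite !mxE thetaE mulrC.
by rewrite /Sprime -mulmxA UE mulKmx.
Qed.
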